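(* Let $C\subset\mathbb{R}^m$ be closed, let $f:\mathbb{R}^n\to\mathbb{R}$ and $g:\mathbb{R}^n\to\mathbb{R}^m$ be twice continuously differentiable, and let $\bar x$ be a feasible point of the problem $\min f(x)$ s.t. $g(x)\in C$ (i.e. $g(\bar x)\in C$). Suppose that for every $u\in\mathcal{C}(\bar x)\setminus\{0\}$ there are $\alpha\ge 0$ and $\lambda\in\mathbb{R}^m$ (possibly depending on $u$) such that $$\nabla_x L^\alpha(\bar x,\lambda)=0\quad\text{and}\quad \nabla^2_{xx}L^\alpha(\bar x,\lambda)(u,u)+{\rm d}^2\delta_C(g(\bar x);\lambda)(\nabla g(\bar x)u)>0 .$$ Then $\bar x$ is an essential local minimizer of second order for this problem.
   Context: $\mathbb{B}(z,\delta)$ is the open ball of radius $\delta$ around $z$. The tangent (contingent) cone to $S$ at $z\in S$ is $T_S(z)=\{w\mid \exists t_k\downarrow0,\ w_k\to w:\ z+t_kw_k\in S\}$. Critical cone: $\mathcal{C}(\bar x)=\{u\in\mathbb{R}^n\mid \nabla g(\bar x)u\in T_C(g(\bar x)),\ \nabla f(\bar x)u\le 0\}$. Generalized Lagrangian: $L^\alpha(x,\lambda)=\alpha f(x)+g(x)^T\lambda$; $\nabla^2_{xx}L^\alpha(\bar x,\lambda)(u,u)=u^T\nabla^2_{xx}L^\alpha(\bar x,\lambda)u$. $\delta_C$ is the indicator function of $C$ ($0$ on $C$, $+\infty$ outside). The second subderivative of $\delta_S$ at $z\in S$ for $z^*$ is the extended-real-valued function $${\rm d}^2\delta_S(z;z^*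 )(w)=\liminf_{t\downarrow0,\ w'\to w}\frac{\delta_S(z+tw')-\delta_S(z)-t\langle z^*,w'\rangle}{\frac12t^2}=\liminf_{t\downarrow0,\ w'\to w,\ z+tw'\in S}\frac{-2\langle z^*,w'\rangle}{t}.$$ A point $\bar x$ is an essential local minimizer of second order for the problem $\min f(x)$ s.t. $g(x)\in C$ if $g(\bar x)\in C$ and there exist $\varepsilon>0$, $\delta>0$ such that $\max\{f(x)-f(\bar x),\,{\rm dist}(g(x),C)\}\ge\varepsilon\|x-\bar x\|^2$ for all $x\in\mathbb{B}(\bar x,\delta)$. *)

(* Defs.v *)
From HB Require Import structures.
From mathcomp Require Import all_boot all_order all_algebra.
From mathcomp Require Import all_classical all_reals all_analysis.

Set Implicit Arguments.
Unset Strict Implicit.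
Unset Printing Implicit Defensive.

Import Order.TTheory GRing.Theory Num.Theory.
Import numFieldNormedType.Exports.

Local Open Scope classical_set_scope.
Local Open Scope ring_scope.

(* Vectors of R^n are row vectors.  The library's topology on 'rV[R]_n is the
   usual one, but its norm `|x| is the sup norm, hence enorm below. *)
Section EuclideanSpace.
Context {R : realType}.

Definition dotv n (u v : 'rV[R]_n) : R := \sum_(i < n) u 0 i * v 0 i.

Definition enorm n (u : 'rV[R]_n) : R := Num.sqrt (dotv u u).

Definition eball n (z : 'rV[R]_n) (r : R) : set 'rV[R]_n :=
  [set x | enorm (x - z) < r].

(* Meaningful for nonempty S only. *)
Definition dist n (y : 'rV[R]_n) (S : set 'rV[R]_n) : R :=
  inf [set enorm (y - c) | c in S].

End EuclideanSpace.

Section Calculus.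
Context {R : realType}.

(* As the domain is finite dimensional, x |-> 'd F x is continuous (resp.
   differentiable, C^1) for the operator norm iff x |-> 'd F x v is so for
   every fixed direction v. *)
Definition C1_map n (W : normedModType R) (F : 'rV[R]_n -> W) : Prop :=
  (forall x, differentiable F x) /\
  (forall v, continuous (fun x => 'd F x v)).

Definition C2_map n (W : normedModType R) (F : 'rV[R]_n -> W) : Prop :=
  (forall x, differentiable F x) /\
  (forall v, C1_map (fun x => 'd F x v)).

Definition partial n (i : 'I_n) (F : 'rV[R]_n -> R) (x : 'rV[R]_n) : R :=
  'D_(delta_mx 0 i) F x.

Definition gradient n (F : 'rV[R]_n -> R) (x : 'rV[R]_n) : 'rV[R]_n :=
  \row_i partial i F x.

Definition hessian n (F : 'rV[R]_n -> R) (x : 'rV[R]_n) : 'M[R]_n :=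
  \matrix_(i, j) partial i (partial j F) x.

Definition quad_form n (A : 'M[R]_n) (u : 'rV[R]_n) : R :=
  (u *m A *m u^T) 0 0.

End Calculus.

Section VariationalAnalysis.
Context {R : realType}.

Definition tangent_cone n (S : set 'rV[R]_n) (z : 'rV[R]_n) : set 'rV[R]_n :=
  [set w | exists (t : nat -> R) (v : nat -> 'rV[R]_n),
    [/\ forall k, 0 < t k, t @ \oo --> (0 : R), v @ \oo --> w
      & forall k, S (z + t k *: v k)]].

Definition indicator n (S : set 'rV[R]_n) (y : 'rV[R]_n) : \bar R :=
  (if y \in S then 0 else +oo)%E.

(* The argument p is the pair (t, w'). *)
Definition second_difference_quotient n (S : set 'rV[R]_n)
    (z zs : 'rV[R]_n) (p : R * 'rV[R]_n) : \bar R :=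
  ((indicator S (z + p.1 *: p.2) - indicator S z - (p.1 * dotv zs p.2)%:E)
   * ((2^-1 * p.1 ^+ 2)^-1)%:E)%E.

Definition second_subderivative n (S : set 'rV[R]_n)
    (z zs w : 'rV[R]_n) : \bar R :=
  limf_einf (second_difference_quotient S z zs)
    (filter_prod (0 : R)^'+ (nbhs w)).

End VariationalAnalysis.

Section ConstrainedProblem.
Context {R : realType} {n m : nat}.
Variables (f : 'rV[R]_n -> R) (g : 'rV[R]_n -> 'rV[R]_m) (C : set 'rV[R]_m).

Definition critical_cone (xbar : 'rV[R]_n) : set 'rV[R]_n :=
  [set u | tangent_cone C (g xbar) ('d g xbar u) /\ 'd f xbar u <= 0].

Definition lagrangian (alpha : R) (lambda : 'rV[R]_m) (x : 'rV[R]_n) : R :=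
  alpha * f x + dotv (g x) lambda.

Definition essential_local_minimizer_second_order (xbar : 'rV[R]_n) : Prop :=
  C (g xbar) /\
  exists eps delta : R, [/\ 0 < eps, 0 < delta &
    forall x, eball xbar delta x ->
      eps * enorm (x - xbar) ^+ 2 <= Num.max (f x - f xbar) (dist (g x) C)].

End ConstrainedProblem.

(* Main.v *)
(* Fix a unit vector [u] and suppose that the growth estimate fails along points
   [x_k = xbar + t_k v_k] with [t_k -> 0+] and [v_k -> u].  Let
   [c_k] in [C] satisfy [g x_k - c_k = o(t_k^2)] and put
   [w_k = (c_k - g xbar) / t_k].  First-order expansions give
   [w_k -> 'd g xbar u] and ['d f xbar u <= 0], so [u] is critical.  For the
   multipliers attached to [u], the second-order expansion of the Lagrangian
   bounds [L x_k - L xbar] below by nearly [t_k^2 / 2] times its Hessian form at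
   [u], while [f x_k - f xbar <= o(t_k^2)] and the second subderivative at
   [(t_k, w_k)] bound it above by less than that.  Hence the estimate holds
   near every direction, with constants uniform over the compact unit sphere. *)

Require Import Defs.
From HB Require Import structures.
From mathcomp Require Import all_boot all_order all_algebra.
From mathcomp Require Import all_classical all_reals all_analysis.
From mathcomp Require Import ring lra.

Import Order.TTheory GRing.Theory Num.Theory.
Import numFieldNormedType.Exports.

Local Open Scope classical_set_scope.
Local Open Scope ring_scope.

(** * Euclidean norm: comparison with the sup norm and compactness of the unit sphere *)

Section EuclideanNorm.
Context {R : realType} {n : nat}.
Implicit Types (u v w : 'rV[R]_n).

Lemma dotvC u v : dotv u v = dotv v u.
Proof. by apply: eq_bigr => i _; rewrite mulrC. Qed.

Lemma dotvv_ge0 u : 0 <= dotv u u.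
Proof. by apply: sumr_ge0 => i _; rewrite -expr2 sqr_ge0. Qed.

Lemma enorm_ge0 u : 0 <= enorm u.
Proof. exact: sqrtr_ge0. Qed.

Lemma enormZ (a : R) u : enorm (a *: u) = `|a| * enorm u.
Proof.
rewrite /enorm; have -> : dotv (a *: u) (a *: u) = a ^+ 2 * dotv u u.
  by rewrite /dotv mulr_sumr; apply: eq_bigr => i _; rewrite !mxE; ring.
by rewrite sqrtrM ?sqr_ge0// sqrtr_sqr.
Qed.

Lemma coord_le_enorm u i : `|u 0 i| <= enorm u.
Proof.
rewrite /enorm -sqrtr_sqr ler_sqrt ?dotvv_ge0// /dotv (bigD1 i)//= expr2 lerDl.
by apply: sumr_ge0 => j _; rewrite -expr2 sqr_ge0.
Qed.

Lemma norm_le_enorm u : `|u| <= enorm u.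
Proof.
rewrite /Num.norm/= mx_normrE; apply: bigmax_le; first exact: enorm_ge0.
by move=> [i j] _ /=; rewrite (ord1 i) coord_le_enorm.
Qed.

Lemma enorm_eq0 u : enorm u = 0 -> u = 0.
Proof.
by move=> u0; apply/eqP; rewrite -normr_le0 -u0 norm_le_enorm.
Qed.

Lemma enorm0 : enorm (0 : 'rV[R]_n) = 0.
Proof. by rewrite -(scale0r (0 : 'rV[R]_n)) enormZ normr0 mul0r. Qed.

(** A coarse form of Cauchy-Schwarz, from bounding each coordinate of [u] by [enorm u]. It suffices
    where [w] is a fixed multiplier. *)
Lemma dotv_le_enorm u w : dotv u w <= enorm u * \sum_(i < n) `|w 0 i|.
Proof.
rewrite /dotv mulr_sumr; apply: ler_sum => i _.
rewrite (le_trans (ler_norm _))// normrM ler_wpM2r//; exact: coord_le_enorm.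
Qed.

Lemma continuous_enorm : continuous (@enorm R n).
Proof.
move=> u; apply: (@continuous_comp _ _ _ (fun v => dotv v v) Num.sqrt).
  apply: (continuous_big add_continuous) => i _ v.
  by apply: continuousM; exact: coord_continuous.
exact: sqrt_continuous.
Qed.

Lemma compact_esphere : compact [set v : 'rV[R]_n | enorm v = 1].
Proof.
apply: bounded_closed_compact.
  exists 1; split => // M M1 v /= v1.
  by rewrite (le_trans (norm_le_enorm v))// v1 ltW.
apply: (@closed_comp _ _ (@enorm R n) [set 1]) => [v _|]; first exact: continuous_enorm.
exact: closed_eq.
Qed.

End EuclideanNorm.

(** * The pairing with a fixed vector, as a continuous linear map *)

Section DotLinear.
Context {R : realType} {n : nat} (w : 'rV[R]_n).

Definition dotr (u : 'rV[R]_n) : R := dotv u w.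

Lemma dotr_is_linear : linear dotr.
Proof.
move=> a u v; rewrite /dotr /dotv /= scaler_sumr -big_split; apply: eq_bigr => i _ /=.
by rewrite !mxE /GRing.scale/=; ring.
Qed.

HB.instance Definition _ :=
  GRing.isLinear.Build R 'rV[R]_n R *:%R dotr dotr_is_linear.

Lemma continuous_dotr : continuous dotr.
Proof.
apply: (continuous_big add_continuous) => i _ u.
by apply: continuousM; [exact: coord_continuous|exact: cst_continuous].
Qed.

End DotLinear.

(** * Smoothness of the Lagrangian *)

Section SmoothMaps.
Context {R : realType} {n : nat}.

(** A continuous linear map is its own differential, so the chain rule just applies [l] to
    ['d F x v]. *)
Lemma C1_map_linear_comp (V W : normedModType R) (l : {linear V -> W})
    (F : 'rV[R]_n -> V) :
  continuous l -> C1_map F -> C1_map (l \o F).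
Proof.
move=> lc [dF cF].
have dl y : differentiable l y by exact: linear_differentiable.
split=> [x|v]; first exact: differentiable_comp.
have -> : (fun x => 'd (l \o F) x v) = l \o (fun x => 'd F x v).
  by apply/funext => x /=; rewrite diff_comp// diff_lin.
by move=> x; apply: continuous_comp; [exact: cF|exact: lc].
Qed.

Lemma C2_map_linear_comp (V W : normedModType R) (l : {linear V -> W})
    (F : 'rV[R]_n -> V) :
  continuous l -> C2_map F -> C2_map (l \o F).
Proof.
move=> lc [dF cF].
have dl y : differentiable l y by exact: linear_differentiable.
split=> [x|v]; first exact: differentiable_comp.
have -> : (fun x => 'd (l \o F) x v) = l \o (fun x => 'd F x v).
  by apply/funext => x /=; rewrite diff_comp// diff_lin.
exact: C1_map_linear_comp.
Qed.

Lemma diffD_apply (W : normedModType R) (F G : 'rV[R]_n -> W) x v :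
  differentiable F x -> differentiable G x ->
  'd (F + G) x v = 'd F x v + 'd G x v.
Proof. by move=> dF dG; exact: (congr1 (fun h => h v) (diffD dF dG)). Qed.

Lemma C1_mapD (W : normedModType R) (F G : 'rV[R]_n -> W) :
  C1_map F -> C1_map G -> C1_map (F + G).
Proof.
move=> [dF cF] [dG cG]; split=> [x|v]; first exact: differentiableD.
have -> : (fun x => 'd (F + G) x v) = (fun x => 'd F x v) \+ (fun x => 'd G x v).
  by apply/funext => x; exact: diffD_apply.
by move=> x; exact: (continuousD (cF v x) (cG v x)).
Qed.

Lemma C2_mapD (W : normedModType R) (F G : 'rV[R]_n -> W) :
  C2_map F -> C2_map G -> C2_map (F + G).
Proof.
move=> [dF cF] [dG cG]; split=> [x|v]; first exact: differentiableD.
have -> : (fun x => 'd (F + G) x v) = (fun x => 'd F x v) \+ (fun x => 'd G x v).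
  by apply/funext => x; exact: diffD_apply.
by apply: C1_mapD; [exact: cF|exact: cG].
Qed.

Lemma C2_map_lagrangian {m} (f : 'rV[R]_n -> R) (g : 'rV[R]_n -> 'rV[R]_m)
    (alpha : R) (lambda : 'rV[R]_m) :
  C2_map f -> C2_map g -> C2_map (lagrangian f g alpha lambda).
Proof.
move=> fC2 gC2.
apply: (@C2_mapD _ (fun x => alpha * f x) (fun x => dotr lambda (g x))).
  apply: (@C2_map_linear_comp R^o R^o ( *:%R alpha) f) => //.
  exact: scaler_continuous.
by apply: C2_map_linear_comp => //; exact: continuous_dotr.
Qed.

End SmoothMaps.

(** * First-order expansions along lines and along converging directions *)

Section Taylor.
Context {R : realType} {n : nat}.
Implicit Types (x u v : 'rV[R]_n).

Lemma is_derive_line (W : normedModType R) (F : 'rV[R]_n -> W) x v (s : R) :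
  differentiable F (x + s *: v) ->
  is_derive s (1 : R) (fun r : R => F (x + r *: v)) ('d F (x + s *: v) v).
Proof.
move=> dF.
have E : (fun h : R => h^-1 *: (((fun r : R => F (x + r *: v)) \o shift s) (h *: 1)
                              - F (x + s *: v)))
   = (fun h : R => h^-1 *: ((F \o shift (x + s *: v)) (h *: v) - F (x + s *: v))).
  apply/funext => h /=; congr (_ *: (F _ - _)).
  by rewrite [h *: 1]mulr1 scalerDl addrCA.
apply: DeriveDef.
  by rewrite /derivable E; exact: diff_derivable.
by rewrite /derive E -deriveE.
Qed.

(** Since the directions [v k] vary, the full differential is used: its remainder is o(|t_k v_k|),
    hence o(t_k) because [v] is bounded. *)
Lemma diff_quotient_cvg (W : normedModType R) (F : 'rV[R]_n -> W) x u
    (t : nat -> R) (v : nat -> 'rV[R]_n) :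
  differentiable F x -> (forall k, 0 < t k) -> t @ \oo --> (0 : R) ->
  v @ \oo --> u ->
  (fun k => (t k)^-1 *: (F (x + t k *: v k) - F x)) @ \oo --> 'd F x u.
Proof.
move=> dF t0 tc vc.
have hc : (fun k => t k *: v k) @ \oo --> (0 : 'rV[R]_n).
  by rewrite -(scale0r u); exact: cvgZ.
have dc : (fun k => 'd F x (v k)) @ \oo --> 'd F x u.
  by apply: continuous_cvg => //; exact: diff_continuous.
have remainder d : 0 < d ->
    \forall h \near nbhs (0 : 'rV[R]_n), `|F (h + x) - F x - 'd F x h| <= d * `|h|.
  move=> d0; near=> h; rewrite (diff_locallyx dF) -addrA -opprD addrC addKr.
  by near: h; exact: littleoP.
apply/cvgrPdist_le => e e0.
have ub : \forall k \near \oo, `|v k| < `|u| + 1.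
  by apply: (cvgr_lt _ (cvg_norm vc)); rewrite ltrDl.
have d0 : 0 < (e / 2) / (`|u| + 1) by rewrite divr_gt0 ?divr_gt0 ?ltr_wpDl.
have /cvgrPdist_le/(_ (e / 2)) dc' := dc.
near=> k.
(* The error splits into the change of direction inside the differential and the scaled remainder;
   each gets [e / 2]. *)
have -> : 'd F x u - (t k)^-1 *: (F (x + t k *: v k) - F x) =
    ('d F x u - 'd F x (v k)) -
    (t k)^-1 *: (F (t k *: v k + x) - F x - 'd F x (t k *: v k)).
  rewrite [x + _]addrC [in RHS]scalerBr ['d F x (t k *: _)]linearZ/=.
  rewrite scalerA mulVf ?gt_eqF// scale1r.
  by rewrite opprB addrA subrK.
rewrite (le_trans (ler_normB _ _))// [e]splitr lerD//.
  by near: k; apply: dc'; rewrite divr_gt0.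
rewrite normrZ gtr0_norm ?invr_gt0// mulrC ler_pdivrMr//.
have ok : `|F (t k *: v k + x) - F x - 'd F x (t k *: v k)| <=
    (e / 2) / (`|u| + 1) * `|t k *: v k|.
  by near: k; exact: (hc _ (remainder _ d0)).
rewrite (le_trans ok)// normrZ gtr0_norm// mulrCA mulrC (ler_pM2r (t0 k)).
rewrite mulrAC ler_pdivrMr ?ltr_wpDl// ler_wpM2l ?divr_ge0 ?(ltW e0)//.
by apply: ltW; near: k.
Unshelve. all: by end_near.
Qed.

End Taylor.

(** * Hessian form and second-order lower bound *)

Section SecondOrder.
Context {R : realType} {n : nat}.
Implicit Types (x y u v : 'rV[R]_n).

Lemma partialE (L : 'rV[R]_n -> R) j y :
  differentiable L y -> partial j L y = 'd L y (delta_mx 0 j).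
Proof. by move=> dL; rewrite /partial deriveE. Qed.

Lemma diff_partial_sum (L : 'rV[R]_n -> R) y v :
  differentiable L y -> 'd L y v = \sum_j v 0 j * partial j L y.
Proof.
move=> dL; rewrite {1}(row_sum_delta v) linear_sum; apply: eq_bigr => j _.
by rewrite linearZ partialE.
Qed.

Lemma C1_map_partial (L : 'rV[R]_n -> R) j : C2_map L -> C1_map (partial j L).
Proof.
move=> [dL cL]; have -> : partial j L = (fun y => 'd L y (delta_mx 0 j)).
  by apply/funext => y; exact: partialE.
exact: cL.
Qed.

Lemma quad_formE (A : 'M[R]_n) u :
  quad_form A u = \sum_j \sum_i u 0 i * A i j * u 0 j.
Proof.
rewrite /quad_form mxE; apply: eq_bigr => j _.
by rewrite !mxE mulr_suml.
Qed.

(** Expanding ['d L] in partial derivatives and differentiating each along the line produces the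
    double sum of the Hessian form. *)
Lemma is_derive_diff_line (L : 'rV[R]_n -> R) x v (s : R) : C2_map L ->
  is_derive s (1 : R) (fun r : R => 'd L (x + r *: v) v)
    (quad_form (hessian L (x + s *: v)) v).
Proof.
move=> LC2; have [dL _] := LC2.
have -> : (fun r : R => 'd L (x + r *: v) v) =
    \sum_j (fun r : R => v 0 j *: partial j L (x + r *: v)).
  by apply/funext => r; rewrite fct_sumE diff_partial_sum.
have -> : quad_form (hessian L (x + s *: v)) v =
    \sum_j v 0 j *: 'd (partial j L) (x + s *: v) v.
  rewrite quad_formE; apply: eq_bigr => j _.
  have [dpj _] := C1_map_partial L j LC2.
  rewrite diff_partial_sum// scaler_sumr; apply: eq_bigr => i _.
  by rewrite !mxE mulrC.
apply: is_derive_sum => j; apply: is_deriveZ.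
have [dpj _] := C1_map_partial L j LC2.
exact: is_derive_line.
Qed.

Lemma continuous_hessian (L : 'rV[R]_n -> R) i j : C2_map L ->
  continuous (fun y => hessian L y i j).
Proof.
move=> LC2; have [dpj cpj] := C1_map_partial L j LC2.
have -> : (fun y => hessian L y i j) = (fun y => 'd (partial j L) y (delta_mx 0 i)).
  by apply/funext => y; rewrite mxE partialE.
exact: cpj.
Qed.

Lemma continuous_quad_form_line (L : 'rV[R]_n -> R) x : C2_map L ->
  continuous (fun p : R * 'rV[R]_n => quad_form (hessian L (x + p.1 *: p.2)) p.2).
Proof.
move=> LC2.
have -> : (fun p : R * 'rV[R]_n => quad_form (hessian L (x + p.1 *: p.2)) p.2) =
    (fun p => \sum_j \sum_i p.2 0 i * hessian L (x + p.1 *: p.2) i j * p.2 0 j).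
  by apply/funext => p; rewrite quad_formE.
have coord i : continuous (fun p : R * 'rV[R]_n => p.2 0 i).
  move=> p; apply: (@continuous_comp _ _ _ snd (fun M : 'rV[R]_n => M 0 i)).
    exact: cvg_snd.
  exact: coord_continuous.
have hess i j : continuous (fun p : R * 'rV[R]_n => hessian L (x + p.1 *: p.2) i j).
  move=> p; apply: (@continuous_comp _ _ _ (fun p : R * 'rV[R]_n => x + p.1 *: p.2)
    (fun y => hessian L y i j)); last exact: continuous_hessian.
  apply: cvgD; first exact: cvg_cst.
  by apply: cvgZ; [exact: cvg_fst|exact: cvg_snd].
apply: (continuous_big add_continuous) => j _.
apply: (continuous_big add_continuous) => i _ p.
exact: (cvgM (cvgM (coord i p) (hess i j p)) (coord j p)).
Qed.

Lemma is_derive_mull (a s : R) : is_derive s (1 : R) (fun r : R => a * r) a.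
Proof.
have := @is_deriveZ _ _ _ _ a _ _ _ (is_derive_id s (1 : R)).
by rewrite [a *: 1]mulr1.
Qed.

Lemma is_derive_half_sqr (a s : R) :
  is_derive s (1 : R) (fun r : R => a / 2 * r ^+ 2) (a * s).
Proof.
have := @is_deriveZ _ _ _ _ (a / 2) _ _ _
  (is_deriveM (is_derive_id s (1 : R)) (is_derive_id s (1 : R))).
have -> // : a / 2 *: (id s *: 1 + id s *: 1) = a * s :> R.
by rewrite /GRing.scale/=; field.
Qed.

(** The mean value theorem is applied twice, to [phi] on [0, t] and then to [dphi] on [0, c]. *)
Lemma le_of_second_derivative_ge0 (phi dphi ddphi : R -> R) (t : R) :
  0 <= t -> (forall s : R, is_derive s (1 : R) phi (dphi s)) ->
  (forall s : R, is_derive s (1 : R) dphi (ddphi s)) ->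
  dphi 0 = 0 -> (forall s, 0 <= s <= t -> 0 <= ddphi s) -> phi 0 <= phi t.
Proof.
move=> t0 dp ddp p0 pos.
have cont (h dh : R -> R) (a b : R) : (forall s : R, is_derive s (1 : R) h (dh s)) ->
    {within `[a, b], continuous h}.
  move=> dh'; apply: derivable_within_continuous => s _.
  by have [] := dh' s.
have [c /[!in_itv]/= /andP[c0 ct]] := MVT_segment t0 (fun s _ => dp s) (cont _ _ _ _ dp).
rewrite subr0 -subr_ge0 => ->; rewrite mulr_ge0//.
have [d /[!in_itv]/= /andP[d0 dc]] := MVT_segment c0 (fun s _ => ddp s) (cont _ _ _ _ ddp).
rewrite p0 !subr0 => ->; rewrite mulr_ge0// pos// d0/=.
exact: le_trans dc ct.
Qed.

(** Subtracting the parabola of curvature [a] from [L] on a line through [x] leaves a function with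
    zero initial slope and nonnegative second derivative. *)
Lemma second_order_lower_bound (L : 'rV[R]_n -> R) x u (a : R) :
  C2_map L -> gradient L x = 0 -> a < quad_form (hessian L x) u ->
  \forall p \near filter_prod (0 : R)^'+ (nbhs u),
    a / 2 * p.1 ^+ 2 <= L (x + p.1 *: p.2) - L x.
Proof.
move=> LC2 gL0 aQ; have [dL _] := LC2.
(* Joint continuity makes the bound uniform in the direction. A two-sided neighbourhood of 0 is
   taken because the bound is needed on all of [0, t], including 0. *)
have : \forall p \near ((0 : R), u), a < quad_form (hessian L (x + p.1 *: p.2)) p.2.
  apply: (cvgr_gt _ (continuous_quad_form_line L x LC2 (0, u))).
  by rewrite /= scale0r addr0.
move=> [[A B]] /= [/nbhs_ballP[d /= d0 dA] uB] AB.
exists ([set t | 0 < t < d], B); first split => //=.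
  near=> t; rewrite /=; apply/andP; split; first by near: t; exact: nbhs_right_gt.
  by near: t; exact: nbhs_right_lt.
move=> [t v] /= [/andP[t0 td] vB].
rewrite lerBrDl.
pose phi (s : R) := L (x + s *: v) - a / 2 * s ^+ 2.
suff : phi 0 <= phi t by rewrite /phi scale0r addr0 expr0n mulr0 subr0 lerBrDr.
apply: (@le_of_second_derivative_ge0 phi (fun s => 'd L (x + s *: v) v - a * s)
  (fun s => quad_form (hessian L (x + s *: v)) v - a)) => //.
- exact: ltW.
- move=> s; apply: is_deriveB; first exact: is_derive_line.
  exact: is_derive_half_sqr.
- move=> s; apply: is_deriveB; first exact: is_derive_diff_line.
  exact: is_derive_mull.
- rewrite scale0r addr0 mulr0 subr0 diff_partial_sum// big1// => j _.
  by move/rowP : gL0 => /(_ j); rewrite !mxE => ->; rewrite mulr0.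
- move=> s /andP[s0 st]; rewrite subr_ge0 ltW//; apply: (AB (s, v)); split => //=.
  by apply: dA; rewrite /ball/= sub0r normrN ger0_norm//; exact: le_lt_trans td.
Unshelve. all: by end_near.
Qed.

End SecondOrder.

(** * Second subderivative of the indicator *)

Section SecondSubderivative.
Context {R : realType} {n : nat}.

(** A lower limit above [r] yields a set of the filter on which the quotient exceeds [r]; at points
    of [S] both indicators vanish and only the linear term remains. *)
Lemma second_subderivative_near (S : set 'rV[R]_n) z zs w (r : R) :
  S z -> (r%:E < second_subderivative S z zs w)%E ->
  \forall p \near filter_prod (0 : R)^'+ (nbhs w),
    S (z + p.1 *: p.2) -> p.1 * dotv zs p.2 <= - (r / 2) * p.1 ^+ 2.
Proof.
move=> Sz; rewrite /second_subderivative limf_einfE.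
move=> /ereal_sup_gt[_ [A FA <-]] rA.
have pos : \forall p \near filter_prod (0 : R)^'+ (nbhs w), 0 < p.1.
  exists ([set t | 0 < t], setT) => [|[t v] []//].
  by split => /=; [exact: nbhs_right_gt|exact: filterT].
apply: filterS2 FA pos => -[t v] Atv /= t0 Sv.
have : (r%:E < second_difference_quotient S z zs (t, v))%E.
  by apply: lt_le_trans rA _; apply: ereal_inf_lbound; exists (t, v).
rewrite /second_difference_quotient /indicator/= !mem_set// oppe0 !add0e -EFinM.
rewrite lte_fin ltr_pdivlMr; last by rewrite mulr_gt0// exprn_gt0.
by move=> ?; lra.
Qed.

End SecondSubderivative.

(** * Quadratic growth near a fixed direction *)

Section LocalGrowth.
Context {R : realType} {n m : nat}.
Context (C : set 'rV[R]_m) (f : 'rV[R]_n -> R) (g : 'rV[R]_n -> 'rV[R]_m).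
Context (xbar : 'rV[R]_n).

Lemma dist_lt (y : 'rV[R]_m) (S : set 'rV[R]_m) (e : R) :
  S !=set0 -> dist y S < e -> exists2 c, S c & enorm (y - c) < e.
Proof.
move=> [c0 Sc0] /inf_lt [|_ [c Sc <-] ce]; last by exists c.
by exists (enorm (y - c0)); exists c0.
Qed.

(** The same [e] is growth constant and ray length, so that compactness has a single parameter to
    make uniform. *)
Definition uniform_growth (e : R) (v : 'rV[R]_n) : Prop :=
  forall t, 0 < t < e ->
    e * t ^+ 2 <= Num.max (f (xbar + t *: v) - f xbar) (dist (g (xbar + t *: v)) C).

Definition violates_growth (e : R) (u : 'rV[R]_n) (t : R) v c : Prop :=
  [/\ 0 < t < e, `|u - v| < e, f (xbar + t *: v) - f xbar <= e * t ^+ 2, C c &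
      enorm (g (xbar + t *: v) - c) <= e * t ^+ 2].

Lemma not_growth_violates u (e : R) : C (g xbar) -> 0 < e ->
  ~ (\forall v \near u & d \near (0 : R)^'+, uniform_growth d v) ->
  exists p : R * 'rV[R]_n * 'rV[R]_m, violates_growth e u p.1.1 p.1.2 p.2.
Proof.
move=> Cg e0; apply: contra_notP => noviol.
exists (ball u e, [set d | 0 < d < e]).
  split => /=; first exact: nbhsx_ballx.
  near=> d; rewrite /=; apply/andP; split; near: d.
    exact: nbhs_right_gt.
  exact: nbhs_right_lt.
move=> [v d] /= [uv /andP[d0 de]] t /andP[t0 td].
rewrite leNgt gt_max; apply/negP => /andP[fd gd].
(* The estimate fails with some constant [d] below [e], so it also fails, up to weak inequalities,
   with [e]. *)
have le : d * t ^+ 2 <= e * t ^+ 2 by rewrite ler_wpM2r ?sqr_ge0// ltW.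
have [|c Cc cd] := dist_lt _ _ _ _ gd; first by exists (g xbar).
apply: noviol; exists (t, v, c); split => //=.
- by rewrite t0/= (lt_trans td).
- by move: uv; rewrite mx_norm_ball.
- exact: le_trans (ltW fd) le.
- exact: le_trans (ltW cd) le.
Unshelve. all: by end_near.
Qed.

(* Negating the estimate on the ball of radius [harmonic k] around [u] yields
   directions tending to [u], so no subsequence has to be extracted. *)
Lemma growth_near_direction u :
  C2_map f -> C2_map g -> C (g xbar) ->
  (critical_cone f g C xbar u ->
   exists (alpha : R) (lambda : 'rV[R]_m),
     [/\ 0 <= alpha, gradient (lagrangian f g alpha lambda) xbar = 0
       & (0 < (quad_form (hessian (lagrangian f g alpha lambda) xbar) u)%:E
              + second_subderivative C (g xbar) lambda ('d g xbar u))%E]) ->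
  \forall v \near u & d \near (0 : R)^'+, uniform_growth d v.
Proof.
move=> fC2 gC2 Cg soc; apply: contrapT => nogrowth.
have [[df _] [dg _]] := (fC2, gC2).
have viol k := not_growth_violates u (harmonic k) Cg (harmonic_gt0 k) nogrowth.
have {viol}[p pviol] := choice viol.
pose h : nat -> R := harmonic.
pose t k := (p k).1.1; pose v k := (p k).1.2; pose c k := (p k).2.
have h0 : h @ \oo --> (0 : R) by exact: cvg_harmonic.
have t_gt0 k : 0 < t k by have [/andP[]] := pviol k.
have t_le k : t k <= h k by have [/andP[_ /ltW]] := pviol k.
have fle k : f (xbar + t k *: v k) - f xbar <= h k * t k ^+ 2 by have [] := pviol k.
have Cc k : C (c k) by have [] := pviol k.
have gle k : enorm (g (xbar + t k *: v k) - c k) <= h k * t k ^+ 2 by have [] := pviol k.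
have tc : t @ \oo --> (0 : R).
  apply: (squeeze_cvgr _ (cvg_cst 0) h0); near=> k.
  by rewrite ltW//=.
have vc : v @ \oo --> u.
  apply/cvgrPdist_le => e e0; near=> k.
  have [_ /ltW uv _ _ _] := pviol k; apply: (le_trans uv).
  by near: k; exact: (cvgr_le _ h0).
have htc : (fun k => h k * t k) @ \oo --> (0 : R).
  by rewrite -(mulr0 0); exact: cvgM.
pose w k := (t k)^-1 *: (c k - g xbar).
have wc : w @ \oo --> 'd g xbar u.
  (* The first term tends to ['d g xbar u]; the second has norm at most [h k * t k]. *)
  have -> : w = (fun k => (t k)^-1 *: (g (xbar + t k *: v k) - g xbar)
      - (t k)^-1 *: (g (xbar + t k *: v k) - c k)).
    apply/funext => k; rewrite -scalerBr; congr (_ *: _).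
    by rewrite opprB [RHS]addrC addrA subrK.
  rewrite -[X in _ --> X]subr0; apply: cvgB.
    exact: diff_quotient_cvg.
  apply/cvgr0Pnorm_le => e e0; near=> k.
  rewrite normrZ gtr0_norm ?invr_gt0// mulrC ler_pdivrMr//.
  rewrite (le_trans (norm_le_enorm _))// (le_trans (gle k))// expr2 mulrA.
  by rewrite ler_pM2r//; near: k; exact: (cvgr_le _ htc).
have gw k : g xbar + t k *: w k = c k.
  by rewrite /w scalerA divff ?gt_eqF// scale1r addrC subrK.
have crit : critical_cone f g C xbar u.
  split; first by exists t, w; split => // k; rewrite gw.
  apply: (ler_cvg_to (diff_quotient_cvg _ _ _ _ _ _ (df xbar) t_gt0 tc vc) htc).
  near=> k; rewrite /GRing.scale/= mulrC ler_pdivrMr//.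
  by rewrite (le_trans (fle k))// expr2 mulrA.
have [alpha [lambda [alpha0 gradL0 pos]]] := soc crit.
set L := lagrangian f g alpha lambda in gradL0 pos.
set H := quad_form _ _ in pos.
(* A real [r] strictly between [- H] and the second subderivative leaves the margin [H + r > 0],
   also when the latter is infinite. *)
have [r Hr rd2] : exists2 r : R, - H < r &
    (r%:E < second_subderivative C (g xbar) lambda ('d g xbar u))%E.
  move: pos; case: second_subderivative => [d| |]//.
    rewrite -EFinD lte_fin => Hd; exists ((d - H) / 2); first by lra.
    by rewrite lte_fin; lra.
  by move=> _; exists (1 - H); [lra|exact: ltry].
have LC2 : C2_map L by exact: C2_map_lagrangian.
(* The curvature used is the midpoint of [- r] and [H]. *)
have aH : (H - r) / 2 < H by lra.
have tr : t @ \oo --> (0 : R)^'+.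
  move=> P rP; have : \forall k \near \oo, 0 < t k -> P (t k) by exact: (tc _ rP).
  by apply: filterS => k; apply.
have near_L : \forall k \near \oo,
    (H - r) / 2 / 2 * t k ^+ 2 <= L (xbar + t k *: v k) - L xbar.
  exact: (cvg_pair tr vc (second_order_lower_bound L xbar u _ LC2 gradL0 aH)).
have near_d2 : \forall k \near \oo,
    C (g xbar + t k *: w k) -> t k * dotv lambda (w k) <= - (r / 2) * t k ^+ 2.
  exact: (cvg_pair tr wc (second_subderivative_near _ _ _ _ _ Cg rd2)).
pose S := \sum_(i < m) `|lambda 0 i|.
have hS : (fun k => h k * (alpha + S)) @ \oo --> (0 : R).
  by rewrite -(mul0r (alpha + S)); apply: cvgM => //; exact: cvg_cst.
(* This is the difference between the coefficient [(H - r) / 4] of the lower bound and the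
   coefficient [- r / 2] from the second subderivative; the remaining errors total at most
   [h k * (alpha + S)] times [t k ^+ 2]. *)
have gap : 0 < (H + r) / 4 by lra.
near \oo => k.
have lower : (H - r) / 2 / 2 * t k ^+ 2 <= L (xbar + t k *: v k) - L xbar.
  by near: k.
have upper : t k * dotv lambda (w k) <= - (r / 2) * t k ^+ 2.
  have : C (g xbar + t k *: w k) by rewrite gw.
  by near: k.
have small : h k * (alpha + S) < (H + r) / 4 by near: k; exact: (cvgr_lt _ hS).
have T0 : 0 < t k ^+ 2 by rewrite exprn_gt0.
(* The increment of [g] passes through [c k], which is [g xbar + t k *: w k]. *)
have dotE : dotv (g (xbar + t k *: v k)) lambda - dotv (g xbar) lambda =
    dotv (g (xbar + t k *: v k) - c k) lambda + t k * dotv lambda (w k).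
  rewrite [dotv lambda _]dotvC -[LHS]/(dotr lambda _ - dotr lambda _).
  rewrite -[RHS]/(dotr lambda _ + t k * dotr lambda _).
  rewrite -gw !linearB/= linearD/= linearZ/=.
  by rewrite /GRing.scale/=; ring.
have dle : dotv (g (xbar + t k *: v k) - c k) lambda <= h k * t k ^+ 2 * S.
  by rewrite (le_trans (dotv_le_enorm _ _))// ler_wpM2r// sumr_ge0.
have fle' : alpha * (f (xbar + t k *: v k) - f xbar) <= alpha * (h k * t k ^+ 2).
  by rewrite ler_wpM2l.
move: small; rewrite -(ltr_pM2r T0).
by move: lower; rewrite /L /lagrangian; lra.
Unshelve. all: by end_near.
Qed.

End LocalGrowth.

(** * From directions to a neighbourhood of [xbar] *)

Theorem theorem3p3 (R : realType) (n m : nat)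
    (C : set 'rV[R]_m) (f : 'rV[R]_n -> R) (g : 'rV[R]_n -> 'rV[R]_m)
    (xbar : 'rV[R]_n)
    (C_closed : closed C) (f_C2 : C2_map f) (g_C2 : C2_map g)
    (xbar_feasible : C (g xbar))
    (second_order_condition : forall u : 'rV[R]_n,
       critical_cone f g C xbar u -> u <> 0 ->
       exists (alpha : R) (lambda : 'rV[R]_m),
         [/\ 0 <= alpha,
             gradient (lagrangian f g alpha lambda) xbar = 0
           & (0 < (quad_form (hessian (lagrangian f g alpha lambda) xbar) u)%:E
                  + second_subderivative C (g xbar) lambda ('d g xbar u))%E]) :
  essential_local_minimizer_second_order f g C xbar.
Proof.
split => //.
have soc u : enorm u = 1 -> \forall v \near u & d \near (0 : R)^'+,
    uniform_growth C f g xbar d v.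
  move=> u1; apply: growth_near_direction => // crit.
  apply: second_order_condition => // u0.
  by move: u1; rewrite u0 enorm0 => /eqP; rewrite eq_sym oner_eq0.
(* Compactness turns the estimates near each unit direction into one valid on the whole sphere for
   all small [d]. *)
have growth := (compact_near_coveringP _).1 compact_esphere _ _ _ _ soc.
have [d [sphere d0]] := filter_ex (filterI (growth _) (nbhs_right_gt (0 : R))).
exists d, d; split => // x xd.
have [->|xN] := eqVneq x xbar.
  by rewrite !subrr enorm0 expr0n mulr0 le_max lexx.
have t0 : 0 < enorm (x - xbar).
  rewrite lt_def enorm_ge0 andbT; apply: contra xN => /eqP/enorm_eq0/eqP.
  by rewrite subr_eq0.
have unitv : enorm ((enorm (x - xbar))^-1 *: (x - xbar)) = 1.
  by rewrite enormZ gtr0_norm ?invr_gt0// mulVf ?gt_eqF.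
(* Polar form: [x] lies at distance [enorm (x - xbar) < d] along its unit direction. *)
have := sphere _ unitv (enorm (x - xbar)).
by rewrite scalerA divff ?gt_eqF// scale1r [xbar + _]addrC subrK t0; exact.
Qed.
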